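(* Let $0<\beta<1$, $a,b,\lambda>0$, and let $\{Q^{\beta}(t,\lambda)\}_{t\ge0}$ be the time fractional negative binomial process with intensity $\lambda$. Let $\{X_{i}\}_{i\ge1}$ be a sequence of iid random variables with distribution function $F(x)=\Pr\{X_1<x\}$, independent of the process. Let $k\ge1$ be an integer and let $X_{(k)}^{Q^{\beta}(t,\lambda)}$ denote the $k$th order statistic from the sample $X_1,\dots,X_{Q^\beta(t,\lambda)}$ of random size $Q^\beta(t,\lambda)$ (defined on $\{Q^\beta(t,\lambda)\ge k\}$). Then, for $t>0$ and $z\in\mathbb{R}$, $$\Pr\{X_{(k)}^{Q^{\beta}(t,\lambda)}<z\,\big|\,Q^{\beta}(t,\lambda)\ge k\}=\frac{\Pr\{Q^{\beta}(t,\lambda F(z))\ge k\}}{\Pr\{Q^{\beta}(t,\lambda)\ge k\}}.$$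
   Context: Time fractional negative binomial process with intensity $\lambda$: $Q^\beta(t,\lambda)=N^\beta(Z(t))$, where $N^\beta(t)=N(Y_\beta(t))$ is the time fractional Poisson process ($N$ a Poisson process of rate $\lambda$ and $Y_\beta$ an independent inverse stable subordinator, $Y_\beta(t)=\inf\{x\ge0:D_\beta(x)>t\}$ with $\mathbb{E}(e^{-sD_\beta(t)})=e^{-ts^\beta}$), and $\{Z(t)\}_{t\ge0}$ is an independent gamma subordinator with density $\frac{a^{bt}}{\Gamma(bt)}x^{bt-1}e^{-ax}$, $x>0$. The process $Q^\beta(t,\lambda F(z))$ is the same process with $\lambda$ replaced by $\lambda F(z)$ (same $a,b,\beta$); for intensity $0$ it is identically $0$. The $k$th order statistic is the $k$th smallest value of the sample. *)

(* Defs.v *)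
From HB Require Import structures.
From mathcomp Require Import all_boot all_order all_algebra finmap.
From mathcomp Require Import all_classical all_reals all_analysis.

Set Implicit Arguments.
Unset Strict Implicit.
Unset Printing Implicit Defensive.

Import Order.TTheory GRing.Theory Num.Theory.
Import numFieldNormedType.Exports.

Local Open Scope classical_set_scope.
Local Open Scope ring_scope.

(* Processes have type [R -> T -> S], time being the first argument; only the
   times [t >= 0] are meaningful, and nothing is assumed about the others. *)

Section independence.
Context {d : measure_display} {T : measurableType d} {R : realType}.
Implicit Type P : probability T R.

Definition conditional_probability P (A B : set T) : R :=
  fine (P (A `&` B)) / fine (P B).

Definition generated_sigma {I : Type} {d' : measure_display}
    {S : measurableType d'} (D : set I) (X : I -> T -> S) : set (set T) :=
  <<s [set A | exists i B, [/\ D i, measurable B & A = X i @^-1` B]] >>.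

Definition independent P (F G : set (set T)) : Prop :=
  forall A B, F A -> G B -> P (A `&` B) = (P A * P B)%E.

Definition mutually_independent {I : choiceType} P (F : I -> set (set T)) :
    Prop :=
  forall (J : {fset I}) (A : I -> set T), (forall i, i \in J -> F i (A i)) ->
    P (\big[setI/setT]_(i <- J) A i) = (\prod_(i <- J) P (A i))%E.

Definition iid P (X : nat -> {RV P >-> R}) : Prop :=
  mutually_independent P (fun i => generated_sigma [set i] X) /\
  forall i (B : set R), measurable B ->
    distribution P (X i) B = distribution P (X 0%N) B.

End independence.

Section processes.
Context {d : measure_display} {T : measurableType d} {R : realType}.
Implicit Type P : probability T R.

Definition process_sigma {d' : measure_display} {S : measurableType d'}
    (X : R -> T -> S) : set (set T) :=
  generated_sigma [set t | 0 <= t] X.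

(* Left limits come for free from monotonicity. *)
Record subordinator P (X : R -> T -> R) : Prop := {
  subordinator_measurable : forall t, 0 <= t -> measurable_fun setT (X t);
  subordinator_start : forall w, X 0 w = 0;
  subordinator_nondecreasing : forall w s t,
    0 <= s -> s <= t -> X s w <= X t w;
  subordinator_right_continuous : forall w t,
    0 <= t -> X s w @[s --> t^'+] --> X t w;
  subordinator_independent_increments : forall tau : nat -> R,
    0 <= tau 0%N -> nondecreasing_seq tau ->
    mutually_independent P (fun i : nat =>
      generated_sigma [set i] (fun j w => X (tau j.+1) w - X (tau j) w));
  subordinator_stationary_increments : forall s h (B : set R),
    0 <= s -> 0 <= h -> measurable B ->
    P [set w | B (X (s + h) w - X s w)] = P [set w | B (X h w)] }.

Definition poisson_process P (lambda : R) (N : R -> T -> nat) : Prop :=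
  subordinator P (fun t w => (N t w)%:R) /\
  forall t n, 0 < t ->
    P [set w | N t w = n] = (poisson_pmf (lambda * t) n)%:E.

Definition stable_subordinator P (beta : R) (D : R -> T -> R) : Prop :=
  subordinator P D /\
  forall t s, 0 <= t -> 0 <= s ->
    'E_P[fun w => expR (- (s * D t w))]%E = (expR (- (t * s `^ beta)))%:E.

(* [inf] of the empty set is 0 here instead of +oo; the set is empty only on
   the null event where the paths of the stable subordinator are bounded. *)
Definition inverse_process (D : R -> T -> R) : R -> T -> R :=
  fun t w => inf [set x | 0 <= x /\ t < D x w].

Definition gamma_function (s : R) : R :=
  \int[lebesgue_measure]_(x in `]0, +oo[) (x `^ (s - 1) * expR (- x)).

Definition gamma_density (a r x : R) : R :=
  a `^ r / gamma_function r * x `^ (r - 1) * expR (- (a * x)).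

Definition gamma_subordinator P (a b : R) (Z : R -> T -> R) : Prop :=
  subordinator P Z /\
  forall t (B : set R), 0 < t -> measurable B ->
    P [set w | B (Z t w)] =
    (\int[lebesgue_measure]_(x in B `&` `]0%R, +oo[)
       (gamma_density a (b * t) x)%:E)%E.

Definition time_change {S : Type} (X : R -> T -> S) (Y : R -> T -> R) :
    R -> T -> S :=
  fun t w => X (Y t w) w.

Definition fractional_poisson_process P (beta lambda : R)
    (Nb : R -> T -> nat) : Prop :=
  exists (N : R -> T -> nat) (D : R -> T -> R),
    [/\ poisson_process P lambda N,
        stable_subordinator P beta D,
        independent P (process_sigma N) (process_sigma (inverse_process D)) &
        forall t w, 0 <= t -> Nb t w = time_change N (inverse_process D) t w].

(* The intensity 0 is treated apart: [poisson_pmf] is a pmf only for a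
   positive parameter. *)
Definition fractional_negative_binomial_process P (beta a b lambda : R)
    (Q : R -> T -> nat) : Prop :=
  if lambda == 0 then forall t w, 0 <= t -> Q t w = 0%N
  else exists (Nb : R -> T -> nat) (Z : R -> T -> R),
    [/\ fractional_poisson_process P beta lambda Nb,
        gamma_subordinator P a b Z,
        independent P (process_sigma Nb) (process_sigma Z) &
        forall t w, 0 <= t -> Q t w = time_change Nb Z t w].

(* [X 0, X 1, ...] stand for X_1, X_2, ...  The value is meaningful only for
   1 <= k <= n. *)
Definition order_statistic (X : nat -> T -> R) (n k : nat) (w : T) : R :=
  nth 0 (sort <=%R (mkseq (fun i => X i w) n)) k.-1.

End processes.

(* Main.v *)
Require Import Defs.
From HB Require Import structures.
From mathcomp Require Import all_boot all_order all_algebra finmap.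
From mathcomp Require Import all_classical all_reals all_analysis.
From mathcomp Require Import measurable_realfun ring lra.

Set Implicit Arguments.
Unset Strict Implicit.
Unset Printing Implicit Defensive.

Import Order.TTheory GRing.Theory Num.Theory.
Import numFieldNormedType.Exports.

Local Open Scope classical_set_scope.
Local Open Scope ring_scope.

(** The theorem is a thinning identity. Put [p = F z] and call an observation
    a hit when it lies below [z]. For [1 <= k <= n], the [k]th smallest of
    [n] values is below [z] exactly when at least [k] of them are hits, so
    the joint event of the conclusion is that the sample of random size [Q t]
    contains at least [k] hits. The hits among [n] iid observations are
    binomial of parameters [n] and [p] ([hits_binomial]), and the sample is
    independent of [Q], so the number of hits in the random sample equals [j]
    with probability [E (binomial_pmf (Q t) p j)] ([hits_random_size]). It
    remains to see that this expectation is [P' (Q' t = j)]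
    ([negative_binomial_thinning]): thinning [Q] independently with retention
    probability [p] has the one-dimensional laws of the same process with
    intensity [lambda * p].

    For a Poisson variable this is the usual rearrangement of an exponential
    series ([binomial_poisson_thinning]). Replacing the fixed time by an
    independent random time [V] preserves identities of the form
    [E (alpha (X u)) = E' (alpha' (X' u))], provided that the random time has
    the same law on both sides ([time_change_transfer]). Instead of
    integrating over the law of [V], one rounds [V] up to a grid point,
    where independence gives an explicit series in the values
    [E (alpha (X u))] and in the distribution function of [V], and refines the
    grid. The paths being locally constant to the right of every time,
    bounded convergence yields the limit, as well as the measurability of the
    time-changed process. This step is used twice, once for the inverse of the
    stable subordinator and once for the gamma subordinator.

    The processes [Q] and [Q'] live on different probability spaces and
    are built from unrelated subordinators, so the laws of the random times
    must be matched. For the gamma subordinator the law is given. For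
    the inverse process, its distribution function is a limit of tail
    probabilities of the stable subordinator ([inverse_process_cdf_cvg]), and
    those are determined by the Laplace transform ([laplace_tail]) because
    explicit polynomials in [exp (- s W)] converge to the indicator of
    [W > u] ([lim_double_exponential]). *)

(** * Integer-valued variables and bounded convergence *)

Section count_variables.
Context {d : measure_display} {T : measurableType d} {R : realType}.
Variable P : probability T R.

Lemma bounded_convergence (f_ : nat -> T -> R) (f : T -> R) :
  (forall n, measurable_fun setT (f_ n)) ->
  (forall n w, 0 <= f_ n w <= 1) ->
  (forall w, f_ n w @[n --> \oo] --> f w) ->
  (\int[P]_w (f_ n w)%:E)%E @[n --> \oo] --> (\int[P]_w (f w)%:E)%E.
Proof.
move=> mf f01 cf.
apply: (@dominated_cvg _ _ _ P setT measurableT (fun n w => (f_ n w)%:E)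
  (fun w => (f w)%:E) (cst 1%E)).
- by move=> n; apply/measurable_EFinP.
- by move=> w _; apply: cvg_EFin; [exact: nearW|exact: cf].
- by [].
- exact: finite_measure_integrable_cst.
- move=> n w _; have /andP[f0 f1] := f01 n w.
  by rewrite gee0_abs ?lee_fin.
Qed.

Lemma measurable_lt (V : T -> R) (c : R) : measurable_fun setT V ->
  measurable [set w | V w < c].
Proof.
by move=> mV; rewrite -preimage_itvNyo -[X in measurable X]setTI; exact: mV.
Qed.

Lemma measurable_gt (V : T -> R) (c : R) : measurable_fun setT V ->
  measurable [set w | c < V w].
Proof.
by move=> mV; rewrite -preimage_itvoy -[X in measurable X]setTI; exact: mV.
Qed.

(** For a map to [nat] this amounts to measurability; it is stated through level
    sets because the laws at hand are given by their probability mass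
    functions. *)
Definition measurable_levels (M : T -> nat) :=
  forall n, measurable [set w | M w = n].

Lemma measurable_levels_preimage (M : T -> nat) (A : set nat) :
  measurable_levels M -> measurable (M @^-1` A).
Proof.
move=> mM; have -> : M @^-1` A = \bigcup_(n in A) [set w | M w = n].
  apply/seteqP; split=> [w Aw|w [n An /= Mn]]; first by exists (M w).
  by rewrite /preimage/= Mn.
by apply: bigcup_measurable => n _.
Qed.

Lemma measurable_fun_levels (M : T -> nat) (alpha : nat -> R) :
  measurable_levels M -> measurable_fun setT (fun w => alpha (M w)).
Proof.
move=> mM _ B _; rewrite setTI.
exact: (measurable_levels_preimage (alpha @^-1` B) mM).
Qed.

Lemma integral_levels (M : T -> nat) (alpha : nat -> R) (B : set T) :
  measurable_levels M -> (forall n, 0 <= alpha n) -> measurable B ->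
  (\int[P]_(w in B) (alpha (M w))%:E =
   \sum_(n <oo) (alpha n)%:E * P ([set w | M w = n] `&` B))%E.
Proof.
move=> mM a0 mB; pose F n := [set w | M w = n] `&` B.
have mF n : measurable (F n) by exact: measurableI.
have BE : B = \bigcup_n F n.
  by apply/seteqP; split=> [w Bw|w [n _ []//]]; exists (M w).
rewrite {1}BE ge0_integral_bigcup//.
- apply: eq_eseriesr => n _.
  rewrite (eq_integral (cst (alpha n)%:E)) ?integral_cst//.
  by move=> w /[!inE] -[/= ->].
- apply/measurable_EFinP; apply: measurable_funS (measurable_fun_levels alpha mM) => //.
- by move=> w _; rewrite lee_fin.
- by move=> i j _ _ [w [[/= <- _] [/= <- _]]].
Qed.

(** Independence is only asked between [B] and the level sets of [M]: the
    integral depends on nothing else. *)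
Lemma integral_levels_indep (M : T -> nat) (alpha : nat -> R) (B : set T) :
  measurable_levels M -> (forall n, 0 <= alpha n) -> measurable B ->
  (forall n, P ([set w | M w = n] `&` B) = (P [set w | M w = n] * P B)%E) ->
  (\int[P]_(w in B) (alpha (M w))%:E =
   \int[P]_w (alpha (M w))%:E * P B)%E.
Proof.
move=> mM a0 mB ind; rewrite !integral_levels//.
have [r rE] : exists r, P B = r%:E.
  by exists (fine (P B)); rewrite fineK// fin_num_measure.
rewrite rE muleC -nneseriesZl; last by move=> i _; rewrite mule_ge0// lee_fin.
by apply: eq_eseriesr => n _; rewrite ind rE setIT muleA muleC.
Qed.

Lemma integral_level_pred (M : T -> nat) (p : pred nat) :
  measurable_levels M ->
  (\int[P]_w ((p (M w))%:R : R)%:E = P [set w | p (M w)])%E.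
Proof.
move=> mM; rewrite (eq_integral (fun w => (\1_[set w | p (M w)] w)%:E)).
  rewrite integral_indic// ?setIT//.
  exact: (measurable_levels_preimage [set n | p n] mM).
move=> w _; rewrite indicE; congr ((nat_of_bool _)%:R%:E).
by apply/idP/idP => [h|/set_mem]; first exact/mem_set.
Qed.

End count_variables.

(** Pointwise stabilization of the membership is a form of convergence that
    also covers non-monotone sequences of events; it transports
    measurability to the limit. *)
Lemma probability_cvg_sets {d : measure_display} {T : measurableType d}
    {R : realType} (P : probability T R) (A_ : nat -> set T) (A : set T) :
  (forall n, measurable (A_ n)) ->
  (forall w, \forall n \near \oo, A_ n w <-> A w) ->
  measurable A /\ P (A_ n) @[n --> \oo] --> P A.
Proof.
move=> mA AA.
have cA w : (\1_(A_ n) w : R) @[n --> \oo] --> (\1_A w : R).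
  apply: cvg_near_cst; apply: filterS (AA w) => n AE.
  rewrite !indicE; congr ((nat_of_bool _)%:R).
  by apply/idP/idP => /set_mem /AE /mem_set.
have mf : measurable_fun setT (\1_A : T -> R).
  apply: measurable_fun_cvg => [n|w _]; last exact: cA.
  exact: measurable_indic.
have mA' : measurable A.
  have := mf measurableT [set 1] (measurable_set1 _); rewrite setTI.
  congr (measurable _); apply/seteqP; split=> w /=; rewrite indicE.
    by case: (boolP (w \in A)) => [/set_mem//|_ /eqP]; rewrite eq_sym oner_eq0.
  by move=> /mem_set ->.
split => //.
have := @bounded_convergence _ _ _ P (fun n => \1_(A_ n)) (\1_A).
rewrite integral_indic// setIT.
under eq_fun do rewrite integral_indic// setIT.
apply => [n|n w|//]; first exact: measurable_indic.
by rewrite indicE ler0n lern1; case: (_ \in _).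
Qed.

(** * Random times independent of a step process *)

Section random_time.
Context {R : realType}.

(** Points [v >= 0] of [cell m i] are rounded up to [grid m i], a time that is
    positive and strictly larger than [v]: right regularity of the paths
    then suffices, and times equal to [0] never have to be considered. *)
Definition grid (m i : nat) : R := i.+1%:R / m.+1%:R.
Definition cell (m i : nat) : set R := [set v | i%:R / m.+1%:R <= v < grid m i].

Lemma grid_gt0 m i : 0 < grid m i.
Proof. by rewrite /grid divr_gt0 ?ltr0n. Qed.

Lemma cellE m i v : 0 <= v -> cell m i v <-> Num.truncn (v * m.+1%:R) = i.
Proof.
move=> v0; rewrite /cell/grid/= ler_pdivrMr ?ltr0n// ltr_pdivlMr ?ltr0n//.
by rewrite -truncn_eq ?mulr_ge0//; split=> /eqP.
Qed.

Lemma measurable_cell m i : measurable (cell m i).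
Proof.
have -> : cell m i = `[i%:R / m.+1%:R, grid m i[%classic.
  by apply/seteqP; split=> v /=; rewrite in_itv.
exact: measurable_itv.
Qed.

Lemma grid_truncn_near (v e : R) : 0 <= v -> 0 < e ->
  \forall m \near \oo, v < grid m (Num.truncn (v * m.+1%:R)) < v + e.
Proof.
move=> v0 e0; have := near_infty_natSinv_lt (PosNum e0).
apply: filterS => m /= me; have m0 : 0 < m.+1%:R :> R by rewrite ltr0n.
have := truncn_itv (mulr_ge0 v0 (ltW m0)) => /andP[le1 lt2].
rewrite /grid ltr_pdivlMr// lt2/= -natr1 mulrDl mul1r ler_ltD//.
by rewrite ler_pdivrMr.
Qed.

(** Right continuity for processes with discrete values, on half-open
    right neighbourhoods of nonnegative times. *)
Definition right_constant {S T : Type} (X : R -> T -> S) :=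
  forall u w, 0 <= u ->
    exists2 e, 0 < e & forall s, u < s < u + e -> X s w = X u w.

(** The requirements on a process [X] and on a random time [V] under which the
    law of [X] at time [V] is determined by the one-dimensional laws of [X] and by
    the law of [V]. *)
Record independent_clock {d : measure_display} {T : measurableType d}
    (P : probability T R) (X : R -> T -> nat) (V : T -> R) : Prop := {
  clock_levels : forall u, 0 <= u -> measurable_levels (X u);
  clock_right_constant : right_constant X;
  clock_measurable : measurable_fun setT V;
  clock_ge0 : forall w, 0 <= V w;
  clock_indep : forall u n (B : set R), 0 <= u -> measurable B ->
    P ([set w | X u w = n] `&` V @^-1` B) =
    (P [set w | X u w = n] * P (V @^-1` B))%E }.

Section discretization.
Context {d : measure_display} {T : measurableType d}.
Variables (P : probability T R) (X : R -> T -> nat) (V : T -> R).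
Hypothesis XV : independent_clock P X V.

Let M m w := X (grid m (Num.truncn (V w * m.+1%:R))) w.

Let mcell m i : measurable (V @^-1` cell m i).
Proof.
rewrite -[X in measurable X]setTI; apply: (clock_measurable XV) => //.
exact: measurable_cell.
Qed.

Let M_cell m i w : (V @^-1` cell m i) w -> M m w = X (grid m i) w.
Proof. by move/(cellE m i (clock_ge0 XV w)) => <-. Qed.

Let mM m : measurable_levels (M m).
Proof.
move=> n; have -> : [set w | M m w = n] =
    \bigcup_i ([set w | X (grid m i) w = n] `&` V @^-1` cell m i).
  apply/seteqP; split=> [w Mn|w [i _ [/= Xn Vi]]]; last by rewrite /= (M_cell Vi).
  exists (Num.truncn (V w * m.+1%:R)) => //; split => //.
  exact/(cellE _ _ (clock_ge0 XV w)).
apply: bigcup_measurable => i _; apply: measurableI => //.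
exact: (clock_levels XV (ltW (grid_gt0 _ _))).
Qed.

Let M_near w : \forall m \near \oo, M m w = X (V w) w.
Proof.
have [e e0 He] := clock_right_constant XV w (clock_ge0 XV w).
by apply: filterS (grid_truncn_near (clock_ge0 XV w) e0) => m; exact: He.
Qed.

Lemma measurable_levels_time_change :
  measurable_levels (fun w => X (V w) w).
Proof.
move=> n; apply: (@probability_cvg_sets _ _ _ P (fun m => [set w | M m w = n])
  _ (fun m => mM m n) _).1 => w.
by apply: filterS (M_near w) => m /= ->.
Qed.

(** The right-hand side is the expectation at the random time; the series is
    the expectation at that time rounded up to the grid, split over the cells
    and factored by independence. *)
Lemma integral_time_change_cvg (alpha : nat -> R) :
  (forall n, 0 <= alpha n <= 1) ->
  (\sum_(i <oo) (\int[P]_w (alpha (X (grid m i) w))%:E) *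
                P (V @^-1` cell m i))%E @[m --> \oo] -->
  (\int[P]_w (alpha (X (V w) w))%:E)%E.
Proof.
move=> a01; have a0 n : 0 <= alpha n by have /andP[] := a01 n.
have -> : (fun m => \sum_(i <oo) (\int[P]_w (alpha (X (grid m i) w))%:E) *
      P (V @^-1` cell m i))%E = (fun m => \int[P]_w (alpha (M m w))%:E)%E.
  apply/funext => m.
  have TE : setT = \bigcup_i (V @^-1` cell m i).
    apply/seteqP; split=> // w _; exists (Num.truncn (V w * m.+1%:R)) => //.
    exact/(cellE _ _ (clock_ge0 XV w)).
  rewrite TE ge0_integral_bigcup// -?TE.
  - apply: eq_eseriesr => i _.
    have Xi := clock_levels XV (ltW (grid_gt0 m i)).
    rewrite -integral_levels_indep//; last first.
      by move=> n; apply: (clock_indep XV) (ltW (grid_gt0 m i)) (measurable_cell m i).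
    by apply: eq_integral => w /[!inE] /M_cell ->.
  - by apply/measurable_EFinP; exact: measurable_fun_levels.
  - by move=> w _; rewrite lee_fin.
  - move=> i j _ _ [w [/(cellE _ _ (clock_ge0 XV w)) <-]].
    by move=> /(cellE _ _ (clock_ge0 XV w)).
apply: bounded_convergence => [m|//|w]; first exact: measurable_fun_levels.
by apply: cvg_near_cst; apply: filterS (M_near w) => m ->.
Qed.

End discretization.

(** Both expectations are limits of the same series, since the probability of
    a cell is a difference of values of the distribution function. The
    hypothesis on [X] and [X'] bears on positive times only, the grid points
    being positive. *)
Lemma time_change_transfer (d d' : measure_display)
    (T : measurableType d) (T' : measurableType d')
    (P : probability T R) (P' : probability T' R)
    (X : R -> T -> nat) (X' : R -> T' -> nat) (V : T -> R) (V' : T' -> R)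
    (alpha alpha' : nat -> R) :
  independent_clock P X V -> independent_clock P' X' V' ->
  (forall n, 0 <= alpha n <= 1) -> (forall n, 0 <= alpha' n <= 1) ->
  (forall u, 0 < u -> (\int[P]_w (alpha (X u w))%:E =
                       \int[P']_w (alpha' (X' u w))%:E)%E) ->
  (forall c, P [set w | V w < c] = P' [set w | V' w < c]) ->
  (\int[P]_w (alpha (X (V w) w))%:E =
   \int[P']_w (alpha' (X' (V' w) w))%:E)%E.
Proof.
move=> XV XV' a01 a01' XX' VV'.
(* Stated for an arbitrary space, to be used on both. *)
have cellP (d0 : measure_display) (T0 : measurableType d0)
    (P0 : probability T0 R) (X0 : R -> T0 -> nat) (V0 : T0 -> R) m i :
    independent_clock P0 X0 V0 -> P0 (V0 @^-1` cell m i) =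
    (P0 [set w | (V0 w < grid m i)%R] -
     P0 [set w | (V0 w < i%:R / m.+1%:R)%R])%E.
  move=> XV0.
  have mV c : measurable [set w | V0 w < c].
    exact: measurable_lt (clock_measurable XV0).
  set A := [set w | (V0 w < grid m i)%R]; set B := [set w | _ < _].
  have BA : A `&` B = B.
    apply/setIidPr => w /= /lt_trans; apply.
    by rewrite /grid ltr_pM2r ?invr_gt0 ?ltr0n// ltr_nat.
  have -> : V0 @^-1` cell m i = A `\` B.
    apply/seteqP; split=> w /=; rewrite /cell/A/B/=.
      by move=> /andP[h1 h2]; split=> //; rewrite ltNge h1.
    by move=> [-> /negP]; rewrite -leNgt => ->.
  by rewrite measureD ?BA ?ltey_eq ?fin_num_measure//; exact: mV.
have := integral_time_change_cvg XV a01.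
have := integral_time_change_cvg XV' a01'.
have -> : (fun m => \sum_(i <oo) (\int[P']_w (alpha' (X' (grid m i) w))%:E) *
      P' (V' @^-1` cell m i))%E =
    (fun m => \sum_(i <oo) (\int[P]_w (alpha (X (grid m i) w))%:E) *
      P (V @^-1` cell m i))%E.
  apply/funext => m; apply: eq_eseriesr => i _.
  by rewrite XX' ?grid_gt0// (cellP _ _ _ _ _ _ _ XV') (cellP _ _ _ _ _ _ _ XV) !VV'.
by move=> /cvg_lim <- // /cvg_lim <-.
Qed.

End random_time.

(** * Laplace transforms determine tails *)

(** Bernoulli's inequality from below and [1 - y <= exp (- y)] from above. *)
Lemma onem_expr_bounds (R : realType) (y : R) (M : nat) : 0 <= y <= 1 ->
  1 - M%:R * y <= (1 - y) ^+ M <= expR (- (M%:R * y)).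
Proof.
move=> /andP[y0 y1]; apply/andP; split.
  elim: M => [|M IH]; first by rewrite mul0r subr0 expr0.
  have h : (1 - y) ^+ M <= 1 by rewrite exprn_ile1 ?subr_ge0// gerBl.
  have h0 : 0 <= (1 - y) ^+ M by rewrite exprn_ge0// subr_ge0.
  rewrite exprS -natr1; nra.
rewrite -mulrN expRM_natl lerXn2r ?nnegrE ?subr_ge0 ?expR_ge0//.
exact: expR_ge1Dx.
Qed.

(** With [v = exp (- s x)], the sequence is [(1 - v ^ N) ^ (N 2 ^ N)] for
    [N = n + 1], and [x > u] means [v < 1 / 2]. Its behaviour is governed by
    [N (2 v) ^ N], which tends to [0] when [v < 1 / 2] and is at least [N]
    otherwise. The extra factor [N] in the exponent is there for the
    boundary case [v = 1 / 2], in which [(1 - v ^ N) ^ (2 ^ N)] would tend to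
    [1 / e] and the limit would not be an indicator. *)
Lemma lim_double_exponential (R : realType) (s : R) (u x : R) :
  expR (s * u) = 2 -> 0 < s -> 0 <= x ->
  (1 - expR (- (n.+1%:R * s * x))) ^+ (n.+1 * 2 ^ n.+1) @[n --> \oo] -->
  ((u < x)%R%:R : R).
Proof.
move=> su s0 x0; set y := fun n : nat => expR (- (n.+1%:R * s * x)).
have y01 n : 0 <= y n <= 1.
  rewrite /y expR_ge0/= -[leRHS]expR0 ler_expR oppr_le0.
  by rewrite !mulr_ge0// ltW.
have My n : (n.+1 * 2 ^ n.+1)%:R * y n =
    n.+1%:R * expR (n.+1%:R * (s * (u - x))).
  rewrite natrM natrX -su -expRM_natl -mulrA -expRD; congr (_ * expR _); ring.
have harm0 : n.+1%:R^-1 @[n --> \oo] --> (0 : R) by exact: cvg_harmonic.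
have [ux|xu] := ltP u x; last first.
  apply: (squeeze_cvgr _ (cvg_cst 0) harm0); apply: nearW => n.
  have /andP[_ h] := onem_expr_bounds (n.+1 * 2 ^ n.+1) (y01 n).
  have /andP[y0 y1] := y01 n.
  rewrite exprn_ge0 ?subr_ge0//=; apply: le_trans h _.
  rewrite My expRN lef_pV2 ?posrE ?expR_gt0//.
  have h1 : 1 <= expR (n.+1%:R * (s * (u - x))).
    by rewrite -[leLHS]expR0 ler_expR !mulr_ge0 ?subr_ge0// ltW.
  have := expR_ge1Dx (n.+1%:R * expR (n.+1%:R * (s * (u - x)))).
  have : 0 < n.+1%:R :> R by rewrite ltr0n.
  nra.
pose c := s * (x - u).
have c0 : 0 < c by rewrite mulr_gt0// subr_gt0.
have low0 : 1 - 4 / c ^+ 2 * n.+1%:R^-1 @[n --> \oo] --> (1 : R).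
  rewrite -[X in _ --> X]subr0; apply: cvgB; first exact: cvg_cst.
  by rewrite -[X in _ --> X](mulr0 (4 / c ^+ 2)); apply: cvgM => //; exact: cvg_cst.
apply: (squeeze_cvgr _ low0 (cvg_cst (1 : R))); apply: nearW => n.
have /andP[h _] := onem_expr_bounds (n.+1 * 2 ^ n.+1) (y01 n).
have /andP[y0 y1] := y01 n.
rewrite exprn_ile1 ?subr_ge0 ?gerBl// andbT; apply: le_trans h.
rewrite lerD2l lerN2 My.
have -> : n.+1%:R * (s * (u - x)) = - (n.+1%:R * c) by rewrite /c; ring.
rewrite expRN.
have n0 : 0 < n.+1%:R :> R by rewrite ltr0n.
set N := n.+1%:R in n0 *.
(* For [x >= 0], [exp x >= (x / 2) ^ 2]; this makes
   [N exp (- N c)] at most [4 / (c ^ 2 N)]. *)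
have e2 : (N * c / 2) ^+ 2 <= expR (N * c).
  have -> : expR (N * c) = expR (N * c / 2) ^+ 2.
    by rewrite -expRM_natl; congr expR; field.
  rewrite lerXn2r ?nnegrE ?expR_ge0//; first by rewrite divr_ge0// mulr_ge0 ?ltW.
  by apply: le_trans (expR_ge1Dx _); rewrite lerDr.
apply: (@le_trans _ _ (N / (N * c / 2) ^+ 2)).
  rewrite ler_pM2l// lef_pV2 ?posrE ?expR_gt0//.
  by rewrite exprn_gt0// divr_gt0// mulr_gt0.
rewrite le_eqVlt; apply/orP; left; apply/eqP; field.
by rewrite !gt_eqF.
Qed.

Section laplace.
Context {R : realType}.

(** A polynomial in [exp (- s W)] has an expectation determined by the Laplace
    transform. The shape [(1 - v) ^ M * v ^ j] is stable under expanding one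
    factor [1 - v], which makes the induction on [M] possible. *)
Lemma laplace_polynomial (d d' : measure_display) (T : measurableType d)
    (T' : measurableType d') (P : probability T R) (P' : probability T' R)
    (W : T -> R) (W' : T' -> R) (s : R) :
  measurable_fun setT W -> measurable_fun setT W' ->
  (forall w, 0 <= W w) -> (forall w, 0 <= W' w) -> 0 <= s ->
  (forall r, 0 <= r -> (\int[P]_w (expR (- (r * W w)))%:E =
                        \int[P']_w (expR (- (r * W' w)))%:E)%E) ->
  forall M j, (\int[P]_w ((1 - expR (- (s * W w))) ^+ M *
                          expR (- (s * W w)) ^+ j)%:E =
    \int[P']_w ((1 - expR (- (s * W' w))) ^+ M *
                expR (- (s * W' w)) ^+ j)%:E)%E.
Proof.
move=> mW mW' W0 W0' s0 L; elim=> [|M IH] j.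
  have h (x : R) : (1 - expR (- (s * x))) ^+ 0 * expR (- (s * x)) ^+ j =
      expR (- (j%:R * s * x)).
    by rewrite expr0 mul1r -expRM_natl; congr expR; ring.
  under eq_integral do rewrite h; under [RHS]eq_integral do rewrite h.
  by rewrite L// mulr_ge0.
have step (d0 : measure_display) (T0 : measurableType d0)
    (P0 : probability T0 R) (W1 : T0 -> R) : measurable_fun setT W1 ->
    (forall w, 0 <= W1 w) ->
    (\int[P0]_w ((1 - expR (- (s * W1 w))) ^+ M.+1 *
                 expR (- (s * W1 w)) ^+ j)%:E =
     \int[P0]_w ((1 - expR (- (s * W1 w))) ^+ M *
                 expR (- (s * W1 w)) ^+ j)%:E -
     \int[P0]_w ((1 - expR (- (s * W1 w))) ^+ M *
                 expR (- (s * W1 w)) ^+ j.+1)%:E)%E.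
  move=> mW1 W10.
  have me : measurable_fun setT (fun w => expR (- (s * W1 w))).
    apply: measurableT_comp; first exact: measurable_expR.
    by apply: measurableT_comp => //; exact: measurable_funM.
  have int i : P0.-integrable setT (fun w =>
      ((1 - expR (- (s * W1 w))) ^+ M * expR (- (s * W1 w)) ^+ i)%:E).
    apply: (@le_integrable _ _ _ _ _ measurableT _ (cst 1%E)); last 1 first.
    - exact: finite_measure_integrable_cst.
    - apply/measurable_EFinP; apply: measurable_funM; apply: measurable_funX => //.
      exact: measurable_funB.
    - move=> w _; have e0 : 0 <= expR (- (s * W1 w)) by exact: expR_ge0.
      have e1 : expR (- (s * W1 w)) <= 1.
        by rewrite -[leRHS]expR0 ler_expR oppr_le0 mulr_ge0.
      rewrite /= lee_fin normr1 ger0_norm ?mulr_ge0 ?exprn_ge0 ?subr_ge0//.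
      by rewrite mulr_ile1 ?exprn_ge0 ?exprn_ile1 ?subr_ge0 ?gerBl.
  rewrite -integralB//; apply: eq_integral => w _.
  by rewrite -EFinB; congr EFin; rewrite !exprS; ring.
by rewrite !step// !IH.
Qed.

(** Uniqueness of the Laplace transform, in the form of an inversion: the tail
    is a limit of polynomial expectations, with [s] chosen so that the
    threshold [exp (- s u)] is [1 / 2]. *)
Lemma laplace_tail (d d' : measure_display) (T : measurableType d)
    (T' : measurableType d') (P : probability T R) (P' : probability T' R)
    (W : T -> R) (W' : T' -> R) :
  measurable_fun setT W -> measurable_fun setT W' ->
  (forall w, 0 <= W w) -> (forall w, 0 <= W' w) ->
  (forall r, 0 <= r -> (\int[P]_w (expR (- (r * W w)))%:E =
                        \int[P']_w (expR (- (r * W' w)))%:E)%E) ->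
  forall u, 0 < u -> P [set w | u < W w] = P' [set w | u < W' w].
Proof.
move=> mW mW' W0 W0' L u u0.
pose s : R := ln 2 / u.
have s0 : 0 < s by rewrite divr_gt0// ln_gt0// ltr1n.
have su : expR (s * u) = 2 by rewrite /s divfK ?gt_eqF// lnK// posrE.
(* Stated for an arbitrary space, to be used on both; the factor to the
   power [0] matches the shape of [laplace_polynomial]. *)
have tail (d0 : measure_display) (T0 : measurableType d0)
    (P0 : probability T0 R) (W1 : T0 -> R) : measurable_fun setT W1 ->
    (forall w, 0 <= W1 w) ->
    (\int[P0]_w ((1 - expR (- (n.+1%:R * s * W1 w))) ^+ (n.+1 * 2 ^ n.+1) *
       expR (- (n.+1%:R * s * W1 w)) ^+ 0)%:E)%E @[n --> \oo] -->
    P0 [set w | u < W1 w].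
  move=> mW1 W10.
  have mA : measurable [set w | u < W1 w] by exact: measurable_gt.
  have <- : (\int[P0]_w (\1_[set w | (u < W1 w)%R] w)%:E)%E =
      P0 [set w | u < W1 w] by rewrite integral_indic// setIT.
  apply: bounded_convergence.
  - move=> n; apply: measurable_funM => //; apply: measurable_funX.
    apply: measurable_funB => //.
    apply: measurableT_comp; first exact: measurable_expR.
    by apply: measurableT_comp => //; exact: measurable_funM.
  - move=> n w; rewrite expr0 mulr1.
    have e0 : 0 <= expR (- (n.+1%:R * s * W1 w)) by exact: expR_ge0.
    have e1 : expR (- (n.+1%:R * s * W1 w)) <= 1.
      by rewrite -[leRHS]expR0 ler_expR oppr_le0 mulr_ge0// mulr_ge0// ltW.
    by rewrite exprn_ge0 ?exprn_ile1 ?subr_ge0 ?gerBl.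
  - move=> w; have -> : \1_[set w | u < W1 w] w = (u < W1 w)%R%:R :> R.
      rewrite indicE; congr ((nat_of_bool _)%:R).
      by apply/idP/idP => h; [exact: (set_mem h)|exact/mem_set].
    under eq_fun do rewrite expr0 mulr1.
    exact: lim_double_exponential.
have := tail _ _ P' _ mW' W0'; have := tail _ _ P _ mW W0.
have Ln n := laplace_polynomial mW mW' W0 W0'
  (mulr_ge0 (ler0n R n.+1) (ltW s0)) L (n.+1 * 2 ^ n.+1) 0.
under [X in X @ _ --> _ -> _]eq_fun do rewrite Ln.
by move=> /cvg_lim <- // /cvg_lim <-.
Qed.

End laplace.

(** * Inverse processes *)

Section inverse.
Context {d : measure_display} {T : measurableType d} {R : realType}.

Lemma inverse_process_ge0 (D : R -> T -> R) u w :
  0 <= inverse_process D u w.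
Proof.
rewrite /inverse_process.
have [->|/set0P S0] := eqVneq [set x | 0 <= x /\ u < D x w] set0.
  by rewrite inf0.
by apply: lb_le_inf => // x [].
Qed.

Lemma has_lbound_passage (D : R -> T -> R) u w :
  has_lbound [set x | 0 <= x /\ u < D x w].
Proof. by exists 0 => x []. Qed.

(** The two alternatives for [inf S < c] with [S] the set of passage times above
    [u]: either [S] has a point below [c], hence [D] exceeds [u] at times
    increasing to [c]; or [S] is empty and the infimum is [0] by convention, hence
    [D] stays below [u] at times tending to infinity. For a given path the left
    member is eventually constant in [n]. *)
Lemma inverse_process_lt_near (D : R -> T -> R) (u c : R) w :
  (forall s t, 0 <= s -> s <= t -> D s w <= D t w) -> 0 < c ->
  \forall n \near \oo,
    (u < D (c * (1 - n.+2%:R^-1)) w \/ D (c + n%:R) w <= u) <->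
    inverse_process D u w < c.
Proof.
move=> Dnd c0; rewrite /inverse_process; set S := [set x | _].
have lbS : has_lbound S by exact: has_lbound_passage.
have [S0|/set0P Sne] := eqVneq S set0.
  rewrite S0 inf0; apply: nearW => n; split=> // _; right.
  rewrite leNgt; apply/negP => uD.
  have : S (c + n%:R) by split => //; rewrite addr_ge0// ltW.
  by rewrite S0.
have [/(inf_lt Sne)[x [x0 uDx] xc]|cS] := ltP (inf S) c.
  have e0 : 0 < (c - x) / c by rewrite divr_gt0// subr_gt0.
  have := near_infty_natSinv_lt (PosNum e0); apply: filterS => n /= ne.
  split=> // _; left; apply: lt_le_trans uDx _; apply: Dnd => //.
  have {ne} : n.+2%:R^-1 < (c - x) / c.
    by apply: le_lt_trans ne; rewrite lef_pV2 ?posrE ?ltr0n// ler_nat.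
  by rewrite ltr_pdivlMr// mulrC mulrBr mulr1 => ne; rewrite lerBrDr addrC -lerBrDr ltW.
have [x [x0 uDx]] := Sne.
(* From here on no passage occurs before [c], but one occurs at [x]. *)
exists (Num.truncn x).+1 => // n /= xn; split=> // -[uD|Du].
  have : S (c * (1 - n.+2%:R^-1)).
    by split=> //; rewrite mulr_ge0 ?(ltW c0)// subr_ge0 invf_le1 ?ltr0n// ler1n.
  move=> /(ge_inf lbS) h; exfalso; move: cS; apply/negP; rewrite -ltNge.
  by apply: le_lt_trans h _; rewrite gtr_pMr// gtrBl invr_gt0 ltr0n.
exfalso; have : D x w <= D (c + n%:R) w.
  apply: Dnd => //; have := truncnS_gt x.
  have : (Num.truncn x).+1%:R <= n%:R :> R by rewrite ler_nat.
  lra.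
by move=> /le_trans /(_ Du); rewrite leNgt uDx.
Qed.

(** The passage time is a right-continuous and, as long as the level is
    reached, nondecreasing function of the level: it approaches its value from
    the right, where [N] is constant. From the supremum of the path
    on, it is constantly [0]. *)
Lemma right_constant_inverse (S : Type) (N : R -> T -> S) (D : R -> T -> R) :
  right_constant N ->
  right_constant (fun u w => N (inverse_process D u w) w).
Proof.
move=> rN u w u0; set y := inverse_process D u w.
have [S0|/set0P Sne] := eqVneq [set x | 0 <= x /\ u < D x w] set0.
  exists 1 => // s /andP[us _]; congr (N _ w).
  rewrite /y /inverse_process S0; congr inf; apply/seteqP; split=> // x [x0 sx].
  by rewrite -S0; split=> //; exact: lt_trans us sx.
have [e e0 He] := rN y w (inverse_process_ge0 _ _ _).
have [|x [x0 ux] xy] := @inf_lt _ _ (y + e) Sne; first by rewrite ltrDl.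
exists (D x w - u) => [|s /andP[us sx]]; first by rewrite subr_gt0.
have {}sx : s < D x w by lra.
have ys : y <= inverse_process D s w.
  apply: lb_le_inf => [|v [v0 sv]]; first by exists x.
  by apply: ge_inf; [exact: has_lbound_passage|split=> //; exact: lt_trans us sv].
move: ys; rewrite le_eqVlt => /predU1P[<-//|ys].
apply: He; rewrite ys/=; apply: le_lt_trans xy.
by apply: ge_inf; [exact: has_lbound_passage|].
Qed.

Lemma right_constant_natr (N : R -> T -> nat) :
  (forall w u, 0 <= u -> (N s w)%:R @[s --> u^'+] --> ((N u w)%:R : R)) ->
  right_constant N.
Proof.
move=> rN u w u0; have /cvgr_dist_lt /(_ 1 ltr01) := rN w u u0.
case/nbhs_ballP => e /= e0 He; exists e => // s /andP[us se].
have := He s; rewrite /ball/= => /(_ _ us).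
rewrite ltr0_norm ?subr_lt0// opprB ltrBlDl => /(_ se).
rewrite ltr_norml => /andP[h1 h2].
have [Nus|Nsu|//] := ltngtP (N s w) (N u w).
  by exfalso; move: Nus; rewrite -(ler_nat R) -natr1 => Nus; lra.
by exfalso; move: Nsu; rewrite -(ler_nat R) -natr1 => Nsu; lra.
Qed.

Lemma bracketing_times (c : R) (n : nat) : 0 <= c ->
  0 <= c * (1 - n.+2%:R^-1) <= c + n%:R.
Proof.
move=> c0; have h : 0 <= 1 - n.+2%:R^-1 :> R.
  by rewrite subr_ge0 invf_le1 ?ltr0n// ler1n.
rewrite mulr_ge0//=; apply: (@le_trans _ _ c); last by rewrite lerDl.
by rewrite ler_piMr// gerBl invr_ge0.
Qed.

Section measurable_inverse.
Variable D : R -> T -> R.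
Hypothesis mD : forall t, 0 <= t -> measurable_fun setT (D t).
Hypothesis D_nd : forall w s t, 0 <= s -> s <= t -> D s w <= D t w.

Let E u c n := [set w | u < D (c * (1 - n.+2%:R^-1)) w] `|`
               [set w | D (c + n%:R) w <= u].

Let mtail t u : 0 <= t -> measurable [set w | u < D t w].
Proof.
by move=> t0; apply: measurable_gt; exact: mD.
Qed.

Let bodyE t u : [set w | D t w <= u] = ~` [set w | u < D t w].
Proof.
by apply/seteqP; split=> w /=; rewrite leNgt => /negP.
Qed.

Let mE u c n : 0 <= c -> measurable (E u c n).
Proof.
move=> c0; have /andP[t0 t1] := bracketing_times n c0.
apply: measurableU; first exact: mtail.
by rewrite bodyE; apply: measurableC; apply: mtail; exact: le_trans t1.
Qed.

Let E_near u c w : 0 < c -> \forall n \near \oo,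
  E u c n w <-> [set w | inverse_process D u w < c] w.
Proof. by move=> c0; apply: inverse_process_lt_near => // s t; exact: D_nd. Qed.

Lemma inverse_process_lt0 u c : c <= 0 ->
  [set w | inverse_process D u w < c] = set0.
Proof.
move=> c0; apply/seteqP; split=> // w /=.
by rewrite ltNge (le_trans c0)// inverse_process_ge0.
Qed.

Lemma measurable_inverse_process (P : probability T R) u :
  measurable_fun setT (inverse_process D u).
Proof.
apply: (measurability _ (RGenInftyO.measurableE R)) => // _ [_ [c ->] <-].
rewrite setTI preimage_itvNyo.
have [c0|c0] := leP c 0; first by rewrite inverse_process_lt0.
exact: (probability_cvg_sets P (fun n => mE u n (ltW c0))
  (fun w => E_near u w c0)).1.
Qed.

(** The two events of [inverse_process_lt_near] are disjoint by monotonicity of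
    the paths, so that their probabilities add up and only tails of [D] at
    fixed times appear. *)
Lemma inverse_process_cdf_cvg (P : probability T R) u c : 0 < c ->
  (P [set w | (u < D (c * (1 - n.+2%:R^-1)) w)%R] +
   (1 - P [set w | (u < D (c + n%:R) w)%R]))%E @[n --> \oo] -->
  P [set w | inverse_process D u w < c].
Proof.
move=> c0; have EP n : P (E u c n) =
    (P [set w | (u < D (c * (1 - n.+2%:R^-1)) w)%R] +
     (1 - P [set w | (u < D (c + n%:R) w)%R]))%E.
  have /andP[t0 t1] := bracketing_times n (ltW c0); have t2 := le_trans t0 t1.
  rewrite /E bodyE measureU.
  - by congr (_ + _)%E; exact: probability_setC (mtail u t2).
  - exact: mtail.
  - by apply: measurableC; exact: mtail.
  - apply/seteqP; split=> // w [/= h1 h2]; apply: h2.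
    by apply: lt_le_trans h1 _; exact: D_nd.
under [X in X @ _ --> _]eq_fun do rewrite -EP.
exact: (probability_cvg_sets P (fun n => mE u n (ltW c0))
  (fun w => E_near u w c0)).2.
Qed.

End measurable_inverse.
End inverse.

Lemma inverse_process_cdf (R : realType) (d d' : measure_display)
    (T : measurableType d) (T' : measurableType d')
    (P : probability T R) (P' : probability T' R)
    (D : R -> T -> R) (D' : R -> T' -> R) (u : R) :
  (forall t, 0 <= t -> measurable_fun setT (D t)) ->
  (forall t, 0 <= t -> measurable_fun setT (D' t)) ->
  (forall w s t, 0 <= s -> s <= t -> D s w <= D t w) ->
  (forall w s t, 0 <= s -> s <= t -> D' s w <= D' t w) ->
  (forall t, 0 <= t -> P [set w | u < D t w] = P' [set w | u < D' t w]) ->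
  forall c, P [set w | inverse_process D u w < c] =
            P' [set w | inverse_process D' u w < c].
Proof.
move=> mD mD' Dnd Dnd' DD' c; have [c0|c0] := leP c 0.
  by rewrite !inverse_process_lt0// !measure0.
have := inverse_process_cdf_cvg mD' Dnd' (P := P') (u := u) c0.
have := inverse_process_cdf_cvg mD Dnd (P := P) (u := u) c0.
have DDn n : ((P [set w | (u < D (c * (1 - n.+2%:R^-1)) w)%R] +
    (1 - P [set w | (u < D (c + n%:R) w)%R])) =
    (P' [set w | (u < D' (c * (1 - n.+2%:R^-1)) w)%R] +
    (1 - P' [set w | (u < D' (c + n%:R) w)%R])))%E.
  have /andP[t0 t1] := bracketing_times n (ltW c0).
  by rewrite DD'// DD'// (le_trans t0).
under [X in X @ _ --> _ -> _]eq_fun do rewrite DDn.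
by move=> /cvg_lim <- // /cvg_lim <-.
Qed.

Lemma stable_subordinator_tail (R : realType) (d d' : measure_display)
    (T : measurableType d) (T' : measurableType d')
    (P : probability T R) (P' : probability T' R) (beta : R)
    (D : R -> T -> R) (D' : R -> T' -> R) :
  stable_subordinator P beta D -> stable_subordinator P' beta D' ->
  forall t u, 0 <= t -> 0 < u ->
    P [set w | u < D t w] = P' [set w | u < D' t w].
Proof.
move=> [sD LD] [sD' LD'] t u t0 u0.
apply: laplace_tail => //.
- exact: subordinator_measurable sD _ t0.
- exact: subordinator_measurable sD' _ t0.
- move=> w; rewrite -(subordinator_start sD w).
  exact: subordinator_nondecreasing sD _ _ _ _ t0.
- move=> w; rewrite -(subordinator_start sD' w).
  exact: subordinator_nondecreasing sD' _ _ _ _ t0.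
- move=> r r0; have := LD _ _ t0 r0; have := LD' _ _ t0 r0.
  by rewrite unlock => -> ->.
Qed.

(** * Binomial thinning of random samples *)

Section thinning.
Context {R : realType}.

Lemma exp_nneseries (x : R) : 0 <= x ->
  (\sum_(n <oo) (x ^+ n / n`!%:R)%:E = (expR x)%:E)%E.
Proof.
move=> x0; rewrite -EFin_lim; last exact: is_cvg_series_exp_coeff.
by apply/congr_lim/funext => n /=; rewrite /series/= -sumEFin.
Qed.

(** After cancelling the factorials, the terms [n = m + j] factor as
    [exp (- c) (c p) ^ j / j!] times the general term [(c (1 - p)) ^ m / m!] of
    an exponential series; the terms [n < j] vanish. *)
Lemma binomial_poisson_thinning (c p : R) (j : nat) :
  0 < c -> 0 < p <= 1 ->
  (\sum_(n <oo) (binomial_pmf n p j)%:E * (poisson_pmf c n)%:E =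
   (poisson_pmf (c * p) j)%:E)%E.
Proof.
move=> c0 /andP[p0 p1].
have p01 : 0 <= p <= 1 by rewrite (ltW p0).
have t0 n : (0 <= (binomial_pmf n p j)%:E * (poisson_pmf c n)%:E)%E.
  by rewrite mule_ge0// lee_fin ?binomial_pmf_ge0 ?poisson_pmf_ge0.
rewrite (nneseries_split _ j)// add0n big1_seq ?add0e; last first.
  move=> n /andP[_]; rewrite mem_index_iota => /andP[_ nj].
  by rewrite /binomial_pmf bin_small// mulr0n mul0e.
rewrite -nneseries_addn//.
have cq0 : 0 <= c * (1 - p) by rewrite mulr_ge0 ?subr_ge0// ltW.
under eq_eseriesr => m _.
  have -> : ((binomial_pmf (m + j) p j)%:E * (poisson_pmf c (m + j))%:E =
      (expR (- c) * (c * p) ^+ j / j`!%:R)%:E *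
      ((c * (1 - p)) ^+ m / m`!%:R)%:E)%E.
    rewrite -!EFinM /binomial_pmf /poisson_pmf c0 addnK /unstable.onem.
    congr EFin; rewrite -mulr_natr.
    have := bin_fact (leq_addl m j); rewrite addnK => /(congr1 (fun n => n%:R : R)).
    rewrite !natrM => <-; rewrite exprMn exprMn exprD.
    field; rewrite !pnatr_eq0 -!lt0n !fact_gt0/= bin_gt0 leq_addl//.
  over.
rewrite nneseriesZl; last by move=> m _; rewrite lee_fin divr_ge0 ?exprn_ge0.
rewrite exp_nneseries// -EFinM /poisson_pmf mulr_gt0//; congr EFin.
have -> : expR (- (c * p)) = expR (- c) * expR (c * (1 - p)).
  by rewrite -expRD; congr expR; ring.
ring.
Qed.

Lemma binomial_pmf_le1 (n j : nat) (p : R) : 0 <= p <= 1 ->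
  binomial_pmf n p j <= 1.
Proof.
move=> p01; have [nj|jn] := ltnP n j.
  by rewrite /binomial_pmf bin_small// mulr0n ler01.
have <- : \sum_(i < n.+1) binomial_pmf n p i = 1.
  transitivity ((unstable.onem p + p) ^+ n); last first.
    by rewrite /unstable.onem subrK expr1n.
  rewrite exprDn; apply: eq_bigr => i _.
  by rewrite /binomial_pmf mulrC.
rewrite (bigD1 (Ordinal (jn : (j < n.+1)%N)))//= lerDl.
by apply: sumr_ge0 => i _; exact: binomial_pmf_ge0.
Qed.

Lemma binomial_pmf0n (p : R) (j : nat) : binomial_pmf 0 p j = (j == 0)%N%:R.
Proof.
by case: j => [|j]; rewrite /binomial_pmf ?bin0n ?mulr0n// !expr0 mulr1.
Qed.

Lemma binomial_pmf_Sn0 (n : nat) (p : R) :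
  binomial_pmf n.+1 p 0 = binomial_pmf n p 0 * (1 - p).
Proof. by rewrite /binomial_pmf /unstable.onem !bin0 !subn0 exprSr; ring. Qed.

Lemma binomial_pmf_SnS (n j : nat) (p : R) :
  binomial_pmf n.+1 p j.+1 =
  binomial_pmf n p j * p + binomial_pmf n p j.+1 * (1 - p).
Proof.
rewrite /binomial_pmf binS subSS /unstable.onem mulrnDr addrC; congr (_ + _).
  by rewrite mulrnAl exprS; congr (_ *+ _); ring.
have [jn|nj] := ltnP j n; last by rewrite bin_small// !mulr0n mul0r.
by rewrite -(subnSK jn) mulrnAl; congr (_ *+ _); rewrite [(1 - p) ^+ _.+1]exprS; ring.
Qed.

Lemma binomial_pmf_p0 (n j : nat) : binomial_pmf n (0 : R) j = (j == 0)%N%:R.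
Proof.
rewrite /binomial_pmf /unstable.onem subr0 expr1n mulr1 expr0n.
by case: j => [|j]; rewrite ?bin0 ?mul0rn.
Qed.

End thinning.

Section sigma.
Context {d : measure_display} {T : measurableType d} {R : realType}.

Lemma generated_sigma_gen (I : Type) (d' : measure_display)
    (S : measurableType d') (D : set I) (X : I -> T -> S) i (B : set S) :
  D i -> measurable B -> generated_sigma D X (X i @^-1` B).
Proof. by move=> Di mB; apply: sub_gen_smallest; exists i, B. Qed.

Lemma generated_sigma_measurable (I : Type) (d' : measure_display)
    (S : measurableType d') (D : set I) (X : I -> T -> S) :
  (forall i, D i -> measurable_fun setT (X i)) ->
  generated_sigma D X `<=` measurable.
Proof.
move=> mX; apply: smallest_sub; first exact: sigma_algebra_measurable.
move=> _ [i [B [Di mB ->]]].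
by rewrite -[X in measurable X]setTI; exact: mX.
Qed.

End sigma.

Section hits.
Context {d : measure_display} {T : measurableType d} {R : realType}.
Variables (P : probability T R) (X : nat -> {RV P >-> R}) (z : R).

Definition hits (n : nat) (w : T) : nat := count (fun i => X i w < z) (iota 0 n).

Let outcome (b : bool) i := if b then [set w | X i w < z] else ~` [set w | X i w < z].

Let hits0 j : [set w | hits 0 w = j.+1] = set0.
Proof. by apply/seteqP; split. Qed.

Let hitsS n w : hits n.+1 w = ((X n w < z)%R + hits n w)%N.
Proof. by rewrite /hits -addn1 iotaD count_cat/= addn0 add0n addnC. Qed.

Let hits_levelS0 n :
  [set w | hits n.+1 w = 0] = [set w | hits n w = 0] `&` outcome false n.
Proof.
apply/seteqP; split=> w /=; rewrite hitsS.
  by case: (boolP (X n w < z)) => //= /negP.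
by case=> -> /negP/negbTE ->.
Qed.

Let hits_levelSS n j :
  [set w | hits n.+1 w = j.+1] =
  ([set w | hits n w = j] `&` outcome true n) `|`
  ([set w | hits n w = j.+1] `&` outcome false n).
Proof.
apply/seteqP; split=> w /=; rewrite hitsS.
  by case: (boolP (X n w < z)) => /= [? [<-]|/negP ? ?]; [left|right].
by case=> [[<- ->]//|[-> /negP/negbTE ->]].
Qed.

Let outcome_sigma (D : set nat) b i : D i -> generated_sigma D X (outcome b i).
Proof.
move=> Di; have h : generated_sigma D X [set w | X i w < z].
  by rewrite -preimage_itvNyo; exact: generated_sigma_gen.
rewrite /outcome; case: b => //.
exact: (@measurableC _ (g_sigma_algebraType [set A | exists i B,
  [/\ D i, measurable B & A = X i @^-1` B]])).
Qed.

(** The recurrence on [n] only uses finite unions and intersections, so it can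
    be carried out in the sigma-algebra of the sample itself; this is what
    independence from the sample size requires. *)
Lemma hits_sigma n j : generated_sigma setT X [set w | hits n w = j].
Proof.
pose T' := g_sigma_algebraType [set A | exists i B,
  [/\ [set: nat] i, measurable B & A = X i @^-1` B]].
rewrite -[generated_sigma _ _ _]/(measurable ([set w | hits n w = j] : set T')).
elim: n j => [|n IH] [|j].
- have -> : [set w | hits 0 w = 0%N] = setT by apply/seteqP; split.
  exact: (@measurableT _ T').
- by rewrite hits0; exact: (@measurable0 _ T').
- by rewrite hits_levelS0; apply: measurableI => //; exact: outcome_sigma.
- rewrite hits_levelSS; apply: measurableU; apply: measurableI => //;
  exact: outcome_sigma.
Qed.

Lemma measurable_levels_hits n : measurable_levels (hits n).
Proof.
move=> j; apply: generated_sigma_measurable (hits_sigma n j) => i _.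
exact: measurable_funPT.
Qed.

Section iid.
Variable p : R.
Hypotheses (hX : iid X) (hp : P [set w | X 0%N w < z] = p%:E).

Let prob (b : bool) : R := if b then p else 1 - p.

Let moutcome b i : measurable (outcome b i).
Proof.
apply: generated_sigma_measurable (@outcome_sigma setT b i I) => k _.
exact: measurable_funPT.
Qed.

Let P_outcome b i : P (outcome b i) = (prob b)%:E.
Proof.
have hpi : P [set w | X i w < z] = p%:E.
  rewrite -hp -(preimage_itvNyo (X i)) -(preimage_itvNyo (X 0%N)).
  exact: hX.2 i _ (measurable_itv `]-oo, z[%R).
case: b => //=; rewrite /outcome probability_setC; last exact: (moutcome true i).
by rewrite hpi -EFinB.
Qed.

Let tail (b : nat -> bool) n m := \big[setI/setT]_(n <= i < m) outcome (b i) i.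

Let mtail b n m : measurable (tail b n m).
Proof. by apply: bigsetI_measurable => i _; exact: moutcome. Qed.

Let P_cylinder b m : P (tail b 0 m) = (\prod_(0 <= i < m) prob (b i))%:E.
Proof.
pose J := [fset i in iota 0 m]%fset.
have J_iota : perm_eq J (index_iota 0 m).
  rewrite /index_iota subn0; apply: uniq_perm => [||i].
  - exact: fset_uniq.
  - exact: iota_uniq.
  - by rewrite !inE.
have := hX.1 J (fun i => outcome (b i) i) (fun i _ => outcome_sigma _ erefl).
rewrite (perm_big _ J_iota)/= (perm_big _ J_iota)/= -/(tail b 0 m) => ->.
by rewrite -prodEFin; apply: eq_bigr => i _; exact: P_outcome.
Qed.

Let tail_ltn b c n m : (n < m)%N -> (forall i, (n < i)%N -> c i = b i) ->
  tail c n m = outcome (c n) n `&` tail b n.+1 m.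
Proof.
move=> nm cb; rewrite /tail big_ltn//; congr (_ `&` _).
by apply: eq_big_nat => i /andP[ni _]; rewrite cb.
Qed.

(** The event on the first [n] observations has to be accompanied by
    prescribed outcomes for the following ones: mutual independence is given for
    cylinders only, and the induction step moves the [n]th observation from the
    count into the cylinder, matching Pascal's rule. *)
Let P_hits_tail b n m j : (n <= m)%N ->
  P ([set w | hits n w = j] `&` tail b n m) =
  (binomial_pmf n p j * \prod_(n <= i < m) prob (b i))%:E.
Proof.
elim: n j b => [|n IH] j b nm.
  case: j => [|j]; rewrite binomial_pmf0n ?mul0r ?mul1r.
    rewrite (_ : [set w | _] = setT) ?setTI; first exact: P_cylinder.
    by apply/seteqP; split.
  by rewrite hits0 set0I measure0.
(* Prescribing the outcome [v] for the [n]th observation turns each of the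
   two slices below into an instance of the induction hypothesis. *)
pose c v i := if i == n then v else b i.
have cb v i : (n < i)%N -> c v i = b i by rewrite /c; case: ltngtP.
have cn v : c v n = v by rewrite /c eqxx.
have slice v k : P ([set w | hits n w = k] `&` outcome v n `&` tail b n.+1 m) =
    (binomial_pmf n p k * prob v * \prod_(n.+1 <= i < m) prob (b i))%:E.
  rewrite -setIA -{1}(cn v) -(tail_ltn nm (cb v)) IH ?(ltnW nm)//.
  rewrite big_ltn// cn mulrA; congr (_ * _)%:E.
  by apply: eq_big_nat => i /andP[ni _]; rewrite cb.
case: j => [|j]; first by rewrite hits_levelS0 slice binomial_pmf_Sn0.
rewrite hits_levelSS setIUl measureU.
- by rewrite binomial_pmf_SnS mulrDl EFinD; congr (_ + _)%E; exact: slice.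
- apply: measurableI => //; apply: measurableI => //; exact: measurable_levels_hits.
- apply: measurableI => //; apply: measurableI => //; exact: measurable_levels_hits.
- apply/seteqP; split=> // w [[[_ h1] _] [[_ h2] _]]; exact: h2.
Qed.

(** Particular case of [P_hits_tail] without later observations. *)
Lemma hits_binomial n j :
  P [set w | hits n w = j] = (binomial_pmf n p j)%:E.
Proof.
have := @P_hits_tail (fun=> true) n n j (leqnn n).
by rewrite /tail !big_geq// setIT mulr1.
Qed.

End iid.

(** Conditioning on the sample size: the count is split along the values of
    [M], which are independent of the sample. *)
Lemma hits_random_size (M : T -> nat) (p : R) j :
  iid X -> P [set w | X 0%N w < z] = p%:E -> 0 <= p <= 1 ->
  measurable_levels M ->
  (forall n A, generated_sigma setT X A ->
    P (A `&` [set w | M w = n]) = (P A * P [set w | M w = n])%E) ->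
  measurable_levels (fun w => hits (M w) w) /\
  P [set w | hits (M w) w = j] = (\int[P]_w (binomial_pmf (M w) p j)%:E)%E.
Proof.
move=> hX hp p01 mM ind.
have HE k : [set w | hits (M w) w = k] =
    \bigcup_n ([set w | hits n w = k] `&` [set w | M w = n]).
  by apply/seteqP; split=> [w h|w [n _ [/= h Mn]]]; [exists (M w)|rewrite /= Mn].
have mH k n : measurable ([set w | hits n w = k] `&` [set w | M w = n]).
  by apply: measurableI => //; exact: measurable_levels_hits.
split=> [k|]; first by rewrite HE; exact: bigcup_measurable.
rewrite HE measure_semi_bigcup//; last 2 first.
- by move=> n n' _ _ [w [[_ /= <-] [_ /= <-]]].
- exact: bigcup_measurable.
rewrite (@integral_levels _ _ _ P M (fun n => binomial_pmf n p j))//; last first.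
  by move=> n; exact: binomial_pmf_ge0.
apply: eq_eseriesr => n _; rewrite setIT -(hits_binomial hX hp).
exact: ind (hits_sigma n j).
Qed.

End hits.

Lemma order_statistic_lt (R : realType) (d : measure_display)
    (T : measurableType d) (P : probability T R) (X : nat -> {RV P >-> R})
    (z : R) (n k : nat) (w : T) : (1 <= k <= n)%N ->
  (order_statistic X n k w < z) = (k <= hits X z n w)%N.
Proof.
move=> /andP[k1 kn]; rewrite /order_statistic; set s := mkseq _ n.
have ss : sorted <=%R (sort <=%R s) by apply: sort_sorted => x y; exact: le_total.
have -> : hits X z n w = count (< z) (sort <=%R s).
  by rewrite count_sort /s /mkseq count_map.
have szs : size (sort <=%R s) = n by rewrite size_sort size_mkseq.
apply/idP/idP => [lt_z|]; last first.
  by move=> kh; apply: nth_count_lt => //; rewrite prednK.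
rewrite leqNgt; apply/negP => hk; move: lt_z; apply/negP; rewrite -leNgt.
have hk' : (count (< z) (sort <=%R s) <= k.-1)%N by rewrite -ltnS prednK.
have /(@all_nthP _ _ _ 0) := filter_all (>= z) (sort <=%R s).
rewrite sorted_filter_ge// => /(_ (k.-1 - count (< z) (sort <=%R s))%N).
rewrite nth_drop size_drop szs subnKC//; apply.
have kn' : (k.-1 < n)%N by rewrite prednK.
by apply: ltn_sub2r => //; exact: leq_ltn_trans hk' kn'.
Qed.

(** * Thinning of fractional negative binomial processes *)

Section clocks.
Context {d : measure_display} {T : measurableType d} {R : realType}.
Variable P : probability T R.

Lemma subordinator_ge0 (Z : R -> T -> R) t w :
  subordinator P Z -> 0 <= t -> 0 <= Z t w.
Proof.
move=> sZ t0; rewrite -(subordinator_start sZ w).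
exact: subordinator_nondecreasing sZ _ _ _ _ t0.
Qed.

Lemma independent_processes (N : R -> T -> nat) (V : R -> T -> R) u t n
    (B : set R) :
  independent P (process_sigma N) (process_sigma V) ->
  0 <= u -> 0 <= t -> measurable B ->
  P ([set w | N u w = n] `&` V t @^-1` B) =
  (P [set w | N u w = n] * P (V t @^-1` B))%E.
Proof.
move=> ind u0 t0 mB; apply: ind; last exact: generated_sigma_gen.
exact: (@generated_sigma_gen _ _ _ _ _ _ N u [set n]).
Qed.

Lemma poisson_clock lambda (N : R -> T -> nat) (D : R -> T -> R) u :
  poisson_process P lambda N -> subordinator P D ->
  independent P (process_sigma N) (process_sigma (inverse_process D)) ->
  0 <= u -> independent_clock P N (inverse_process D u).
Proof.
move=> [sN _] sD ind u0; split.
- move=> s s0 n; rewrite -[X in measurable X]setTI.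
  have := subordinator_measurable sN s0 measurableT (measurable_set1 (n%:R : R)).
  congr (measurable (_ `&` _)); apply/seteqP; split=> w /= => [/eqP|->//].
  by rewrite eqr_nat => /eqP.
- apply: right_constant_natr => w s s0.
  exact: subordinator_right_continuous sN _ _ s0.
- apply: (@measurable_inverse_process _ _ _ D _ _ P).
  + exact: subordinator_measurable sD.
  + exact: subordinator_nondecreasing sD.
- by move=> w; exact: inverse_process_ge0.
- by move=> s n B s0 mB; exact: independent_processes.
Qed.

(** The fractional Poisson process is itself a time change, so that its
    measurability and the regularity of its paths come from those of the
    Poisson process and of the passage times. *)
Lemma fractional_poisson_clock beta lambda a b (Nb : R -> T -> nat)
    (Z : R -> T -> R) t :
  fractional_poisson_process P beta lambda Nb -> gamma_subordinator P a b Z ->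
  independent P (process_sigma Nb) (process_sigma Z) ->
  0 <= t -> independent_clock P Nb (Z t).
Proof.
move=> [N [D [pN [sD _] ind NbE]]] [sZ _] indZ t0.
have NbE' u : 0 <= u -> Nb u = fun w => N (inverse_process D u w) w.
  by move=> u0; apply/funext => w; rewrite NbE.
split.
- move=> u u0; rewrite NbE'//.
  exact: measurable_levels_time_change (poisson_clock pN sD ind u0).
- move=> u w u0.
  have rN := clock_right_constant (poisson_clock pN sD ind u0).
  have [e e0 He] := right_constant_inverse D rN w u0.
  exists e => // s /andP[us se]; rewrite !NbE'//; last exact: le_trans (ltW us).
  by apply: He; rewrite us.
- exact: subordinator_measurable sZ _ t0.
- by move=> w; exact: subordinator_ge0 sZ t0.
- by move=> s n B s0 mB; exact: independent_processes.
Qed.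

End clocks.

Section thinned_process.
Context {R : realType} {d d' : measure_display}.
Context {T : measurableType d} {T' : measurableType d'}.
Variables (P : probability T R) (P' : probability T' R).
Variables (beta a b lambda p : R) (j : nat).
Hypotheses (lambda0 : 0 < lambda) (p01 : 0 < p <= 1).

Let bin (n : nat) : R := binomial_pmf n p j.
Let one (n : nat) : R := (n == j)%:R.

Let bin01 n : 0 <= bin n <= 1.
Proof.
have p01' : 0 <= p <= 1 by case/andP: p01 => /ltW ->.
by rewrite /bin binomial_pmf_ge0// binomial_pmf_le1.
Qed.

Let one01 n : 0 <= one n <= 1.
Proof. by rewrite /one ler0n lern1; case: (_ == _). Qed.

Let poisson_thinning (N : R -> T -> nat) (N' : R -> T' -> nat) u :
  poisson_process P lambda N -> poisson_process P' (lambda * p) N' ->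
  measurable_levels (N u) -> measurable_levels (N' u) -> 0 < u ->
  (\int[P]_w (bin (N u w))%:E = \int[P']_w (one (N' u w))%:E)%E.
Proof.
move=> [_ NE] [_ NE'] mN mN' u0; have b0 n : 0 <= bin n by case/andP: (bin01 n).
rewrite (integral_level_pred P' (fun n => n == j))// integral_levels//.
rewrite (_ : [set w | N' u w == j] = [set w | N' u w = j]); last first.
  by apply/seteqP; split=> w /= /eqP.
rewrite NE'// mulrAC -binomial_poisson_thinning// ?mulr_gt0//.
by apply: eq_eseriesr => n _; rewrite setIT NE.
Qed.

Let fractional_poisson_thinning (Nb : R -> T -> nat) (Nb' : R -> T' -> nat) u :
  fractional_poisson_process P beta lambda Nb ->
  fractional_poisson_process P' beta (lambda * p) Nb' -> 0 < u ->
  (\int[P]_w (bin (Nb u w))%:E = \int[P']_w (one (Nb' u w))%:E)%E.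
Proof.
move=> [N [D [pN sD ind NbE]]] [N' [D' [pN' sD' ind' NbE']]] u0.
have NV := poisson_clock pN sD.1 ind (ltW u0).
have NV' := poisson_clock pN' sD'.1 ind' (ltW u0).
under eq_integral do rewrite NbE ?ltW//.
under [RHS]eq_integral do rewrite NbE' ?ltW//.
apply: (time_change_transfer NV NV' bin01 one01).
  move=> s s0; apply: poisson_thinning => //.
    exact: (clock_levels NV (ltW s0)).
  exact: (clock_levels NV' (ltW s0)).
apply: inverse_process_cdf.
- exact: subordinator_measurable sD.1.
- exact: subordinator_measurable sD'.1.
- exact: subordinator_nondecreasing sD.1.
- exact: subordinator_nondecreasing sD'.1.
- by move=> t t0; exact: stable_subordinator_tail sD sD' _ _ t0 u0.
Qed.

(** The Poisson identity transported through both time changes; the clocks have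
    the same law on both sides because neither depends on the intensity. *)
Lemma negative_binomial_thinning (Q : R -> T -> nat) (Q' : R -> T' -> nat) t :
  fractional_negative_binomial_process P beta a b lambda Q ->
  fractional_negative_binomial_process P' beta a b (lambda * p) Q' -> 0 < t ->
  (\int[P]_w (bin (Q t w))%:E = \int[P']_w (one (Q' t w))%:E)%E.
Proof.
case/andP: (p01) => p0 _; rewrite /fractional_negative_binomial_process.
rewrite mulf_eq0 !gt_eqF//= => -[Nb [Z [fN gZ ind QE]]].
move=> [Nb' [Z' [fN' gZ' ind' QE']]] t0.
under eq_integral do rewrite QE ?ltW//.
under [RHS]eq_integral do rewrite QE' ?ltW//.
apply: (time_change_transfer (fractional_poisson_clock fN gZ ind (ltW t0))
  (fractional_poisson_clock fN' gZ' ind' (ltW t0)) bin01 one01).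
  by move=> u u0; exact: fractional_poisson_thinning.
move=> c; have cE (d0 : measure_display) (T0 : measurableType d0) (V : T0 -> R) :
    [set w | V w < c] = [set w | `]-oo, c[%classic (V w)].
  by rewrite -preimage_itvNyo.
by rewrite (cE _ _ (Z t)) (cE _ _ (Z' t)) gZ.2// gZ'.2.
Qed.

End thinned_process.

Lemma measurable_levels_negative_binomial (R : realType) (d : measure_display)
    (T : measurableType d) (P : probability T R) (beta a b lambda : R)
    (Q : R -> T -> nat) t :
  fractional_negative_binomial_process P beta a b lambda Q -> 0 < t ->
  measurable_levels (Q t).
Proof.
rewrite /fractional_negative_binomial_process; case: ifP => [_ Q0|_] => [t0 n|].
  have [->|n0] := eqVneq n 0%N.
    rewrite (_ : [set w | _] = setT)//; apply/seteqP; split=> // w _ /=.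
    by rewrite Q0 ?ltW.
  rewrite (_ : [set w | _] = set0)//; apply/seteqP; split=> // w /=.
  by rewrite Q0 ?ltW// => n0'; rewrite -n0' eqxx in n0.
move=> [Nb [Z [fN gZ ind QE]]] t0.
have -> : Q t = (fun w => Nb (Z t w) w) by apply/funext => w; rewrite QE ?ltW.
exact: measurable_levels_time_change (fractional_poisson_clock fN gZ ind (ltW t0)).
Qed.

Lemma same_levels_same_law (R : realType) (d d' : measure_display)
    (T : measurableType d) (T' : measurableType d')
    (P : probability T R) (P' : probability T' R)
    (M : T -> nat) (M' : T' -> nat) (q : pred nat) :
  measurable_levels M -> measurable_levels M' ->
  (forall n, P [set w | M w = n] = P' [set w | M' w = n]) ->
  P [set w | q (M w)] = P' [set w | q (M' w)].
Proof.
move=> mM mM' MM'; rewrite -!integral_level_pred//.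
have q0 n : 0 <= (q n)%:R :> R by [].
rewrite (integral_levels P mM q0 measurableT).
rewrite (integral_levels P' mM' q0 measurableT).
by apply: eq_eseriesr => n _; rewrite !setIT MM'.
Qed.

Theorem theorem5p3 (R : realType)
  (d : measure_display) (T : measurableType d) (P : probability T R)
  (beta a b lambda : R)
  (hbeta : 0 < beta < 1) (ha : 0 < a) (hb : 0 < b) (hlambda : 0 < lambda)
  (Q : R -> T -> nat)
  (hQ : fractional_negative_binomial_process P beta a b lambda Q)
  (X : nat -> {RV P >-> R}) (hX : iid X)
  (F : R -> R) (hF : forall x, P [set w | X 0%N w < x] = (F x)%:E)
  (hXQ : independent P (generated_sigma [set: nat] X) (process_sigma Q))
  (k : nat) (hk : (1 <= k)%N) (t : R) (ht : 0 < t) (z : R)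
  (d' : measure_display) (T' : measurableType d') (P' : probability T' R)
  (Q' : R -> T' -> nat)
  (hQ' : fractional_negative_binomial_process P' beta a b (lambda * F z) Q') :
  conditional_probability P
    [set w | order_statistic X (Q t w) k w < z] [set w | (k <= Q t w)%N] =
  fine (P' [set w | (k <= Q' t w)%N]) / fine (P [set w | (k <= Q t w)%N]).
Proof.
have mQ := measurable_levels_negative_binomial hQ ht.
have mQ' := measurable_levels_negative_binomial hQ' ht.
have F01 : 0 <= F z <= 1.
  rewrite -!lee_fin -hF measure_ge0 probability_le1//.
  by apply: measurable_lt; exact: measurable_funPT.
have ind n A : generated_sigma [set: nat] X A ->
    P (A `&` [set w | Q t w = n]) = (P A * P [set w | Q t w = n])%E.
  move=> XA; apply: hXQ => //.
  by apply: (@generated_sigma_gen _ _ _ _ _ _ Q t [set n]) => //=; exact: ltW.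
have [mH _] := hits_random_size 0 hX (hF z) F01 mQ ind.
have HQ' j : P [set w | hits X z (Q t w) w = j] = P' [set w | Q' t w = j].
  have [_ ->] := hits_random_size j hX (hF z) F01 mQ ind.
  have -> : [set w | Q' t w = j] = [set w | Q' t w == j].
    by apply/seteqP; split=> w /= /eqP.
  rewrite -(integral_level_pred P' (fun n => n == j))//.
  (* When [F z = 0] both sides are the indicator of [j = 0], the process [Q']
     being identically [0]. *)
  case/andP: F01; rewrite le_eqVlt => /predU1P[F0|F0] F1; last first.
    by apply: negative_binomial_thinning hQ hQ' ht; rewrite ?F0.
  move: hQ'; rewrite -F0 mulr0 /fractional_negative_binomial_process eqxx => Q0.
  under eq_integral do rewrite binomial_pmf_p0.
  under [RHS]eq_integral do rewrite Q0 ?ltW// eq_sym.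
  rewrite !integral_cst//; congr (_ * _)%E.
  transitivity (1%E : \bar R); first exact: probability_setT.
  exact/esym/probability_setT.
rewrite /conditional_probability; congr (fine _ / _).
rewrite -(same_levels_same_law (fun n => k <= n)%N mH mQ' HQ').
congr (P _); apply/seteqP; split=> w /=.
  by move=> [ltz kQ]; rewrite -order_statistic_lt ?hk.
move=> kH; have kQ : (k <= Q t w)%N.
  by apply: leq_trans kH _; rewrite -{2}(size_iota 0 (Q t w)) count_size.
by rewrite order_statistic_lt ?hk.
Qed.
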